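(* Let $d\in\mathbb{N}$. Assume that $n,N\in\mathbb{N}$ with $n\le N$ and $\boldsymbol{p}\in N^{-1}\,\mathbb{N}_0^d\cap \mathrm{Int}(\mathcal{S}_d)$, and pick any $\gamma\in(0,1)$. Then, uniformly for $\boldsymbol{k}\in\mathbb{K}_d$ such that $\max_{1\le i\le d+1}(k_i/p_i)\le \gamma N$ and $n\le\gamma N$, we have, as $N\to\infty$, $$\log\left(\frac{P_{N,n,\boldsymbol{p}}(\boldsymbol{k})}{Q_{n,\boldsymbol{p}}(\boldsymbol{k})}\right)=\frac1N\left[\left(\frac{n^2}{2}-\frac n2\right)-\sum_{i=1}^{d+1}\frac1{p_i}\left(\frac{k_i^2}{2}-\frac{k_i}{2}\right)\right]+\mathcal{O}_\gamma\left(\frac1{N^2}\left[n^3+\sum_{i=1}^{d+1}\frac{k_i^3}{p_i^2}\right]\right),$$ and $$\begin{aligned}\log\left(\frac{P_{N,n,\boldsymbol{p}}(\boldsymbol{k})}{Q_{n,\boldsymbol{p}}(\boldsymbol{k})}\right)&=\frac1N\left[\left(\frac{n^2}{2}-\frac n2\right)-\sum_{i=1}^{d+1}\frac1{p_i}\left(\frac{k_i^2}{2}-\frac{k_i}{2}\right)\right]\\&\quad+\frac1{N^2}\left[\left(\frac{n^3}{6}-\frac{n^2}{4}+\frac n{12}\right)-\sum_{i=1}^{d+1}\frac1{p_i^2}\left(\frac{k_i^3}{6}-\frac{k_i^2}{4}+\frac{k_i}{12}\right)\right]\\&\quad+\mathcal{O}_\gamma\left(\frac1{N^3}\left[n^4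+\sum_{i=1}^{d+1}\frac{k_i^4}{p_i^3}\right]\right).\end{aligned}$$
   Context: $\mathbb{N}=\{1,2,\dots\}$, $\mathbb{N}_0=\mathbb{N}\cup\{0\}$, and $\|\boldsymbol{x}\|_1=\sum_{i=1}^d|x_i|$ on $\mathbb{R}^d$. The simplex and its interior are $\mathcal{S}_d=\{\boldsymbol{x}\in[0,1]^d:\|\boldsymbol{x}\|_1\le1\}$ and $\mathrm{Int}(\mathcal{S}_d)=\{\boldsymbol{x}\in(0,1)^d:\|\boldsymbol{x}\|_1<1\}$. For $\boldsymbol{p}\in N^{-1}\mathbb{N}_0^d\cap\mathrm{Int}(\mathcal{S}_d)$ (so $Np_i$ is an integer for each $i$) put $p_{d+1}=1-\|\boldsymbol{p}\|_1>0$, and for $\boldsymbol{k}\in\mathbb{N}_0^d\cap n\mathcal{S}_d$ put $k_{d+1}=n-\|\boldsymbol{k}\|_1$. Define $\mathbb{K}_d=\{\boldsymbol{k}\in\mathbb{N}_0^d\cap n\mathcal{S}_d: k_i\in[0,Np_i]\text{ for all }1\le i\le d+1\}$. The $\mathrm{Hypergeometric}(N,n,\boldsymbol{p})$ probability mass function is $$P_{N,n,\boldsymbol{p}}(\boldsymbol{k})=\frac{\prod_{i=1}^{d+1}\binom{Np_i}{k_i}}{\binom Nn},\qquad \boldsymbol{k}\in\mathbb{K}_d,$$ and the $\mathrm{Multinomial}(n,\boldsymbol{p})$ probability mass function is $$Q_{n,\boldsymbol{p}}(\boldsymbol{k})=\frac{n!}{\prod_{i=1}^{d+1}k_i!}\prod_{i=1}^{d+1}p_i^{k_i},\qquad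 \boldsymbol{k}\in\mathbb{N}_0^d\cap n\mathcal{S}_d.$$ Convention: $u=\mathcal{O}(v)$ means $\limsup_{N\to\infty}|u/v|<C$ where $C\in(0,\infty)$ is a universal constant; a subscript, as in $\mathcal{O}_\gamma$, means that $C$ may depend on that parameter (here $\gamma$). *)

(* Defs.v *)
From HB Require Import structures.
From mathcomp Require Import all_boot all_order all_algebra.
From mathcomp Require Import all_classical all_reals all_analysis.

Set Implicit Arguments.
Unset Strict Implicit.
Unset Printing Implicit Defensive.

Import Order.TTheory GRing.Theory Num.Theory.
Import numFieldNormedType.Exports.

Local Open Scope classical_set_scope.
Local Open Scope ring_scope.

(* The library norm on row vectors is the sup norm. *)
Definition l1norm (R : realType) (d : nat) (x : 'rV[R]_d) : R :=
  \sum_(i < d) `|x 0 i|.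

Definition simplex (R : realType) (d : nat) : set 'rV[R]_d :=
  [set x : 'rV[R]_d | (forall i, 0 <= x 0 i <= 1) /\ l1norm x <= 1].

Definition int_simplex (R : realType) (d : nat) : set 'rV[R]_d :=
  [set x : 'rV[R]_d | (forall i, 0 < x 0 i < 1) /\ l1norm x < 1].

Definition natvec (R : realType) (d : nat) (k : 'I_d -> nat) : 'rV[R]_d :=
  \row_i (k i)%:R.

Definition grid (R : realType) (d N : nat) : set 'rV[R]_d :=
  [set N%:R^-1 *: natvec R m | m in [set: 'I_d -> nat]].

(* Coordinate d+1 of a d-dimensional vector is stored at [ord_max : 'I_d.+1],
   coordinate i <= d at [lift ord_max i], which has the same value as i. *)
Definition pext (R : realType) (d : nat) (p : 'rV[R]_d) (i : 'I_d.+1) : R :=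
  if unlift ord_max i is Some j then p 0 j else 1 - l1norm p.

(* The subtraction is exact on the integer points of n * simplex. *)
Definition kext (d n : nat) (k : 'I_d -> nat) (i : 'I_d.+1) : nat :=
  if unlift ord_max i is Some j then k j else (n - \sum_(j < d) k j)%N.

Definition scaled_simplex (R : realType) (d n : nat) : set ('I_d -> nat) :=
  [set k : 'I_d -> nat | [set n%:R *: x | x in @simplex R d] (natvec R k)].

Definition Kset (R : realType) (d N n : nat) (p : 'rV[R]_d) :
    set ('I_d -> nat) :=
  [set k : 'I_d -> nat | scaled_simplex R n k /\
           forall i : 'I_d.+1, (kext n k i)%:R <= N%:R * pext p i].

(* For p in the grid, N p_i is a natural number and [Num.truncn] merely casts
   it back to nat. *)
Definition hypergeometric_pmf (R : realType) (d N n : nat) (p : 'rV[R]_d)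
    (k : 'I_d -> nat) : R :=
  (\prod_(i < d.+1) ('C(Num.truncn (N%:R * pext p i), kext n k i))%:R)
  / ('C(N, n))%:R.

Definition multinomial_pmf (R : realType) (d n : nat) (p : 'rV[R]_d)
    (k : 'I_d -> nat) : R :=
  (n`!)%:R / (\prod_(i < d.+1) ((kext n k i)`!)%:R)
  * \prod_(i < d.+1) pext p i ^+ kext n k i.

(* The default value 0 of the maximum is harmless: all the ratios are
   nonnegative. *)
Definition regime (R : realType) (gamma : R) (d N n : nat) (p : 'rV[R]_d)
    (k : 'I_d -> nat) : Prop :=
  [/\ (0 < n)%N /\ (n <= N)%N,
      grid N p /\ int_simplex p,
      Kset N n p k,
      \big[Num.max/0]_(i < d.+1) ((kext n k i)%:R / pext p i) <= gamma * N%:R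
    & n%:R <= gamma * N%:R].

(* u = O(v) with constant C as N -> oo, uniformly over the (n, p, k) of the
   regime, which may all vary with N: limsup_N sup_(n, p, k) |u / v| < C.
   The supremum is -oo for those N for which the regime is empty. *)
Definition unif_bigO (R : realType) (gamma C : R) (d : nat)
    (u v : nat -> nat -> 'rV[R]_d -> ('I_d -> nat) -> R) : Prop :=
  (limn_esup (fun N : nat =>
     ereal_sup [set e : \bar R | exists n p k,
       regime gamma N n p k /\ e = `|u N n p k / v N n p k|%:E])
   < C%:E)%E.

(* Main.v *)
Require Import Defs.
From HB Require Import structures.
From mathcomp Require Import all_boot all_order all_algebra.
From mathcomp Require Import all_classical all_reals all_analysis.
From mathcomp Require Import ring lra.

(** Write m_i = N p_i, and m^_k for the falling factorial m (m-1) ... (m-k+1).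
    Since a binomial coefficient 'C(m, k) is m^_k / k!, all the factorials of
    the two mass functions cancel in their quotient; since the k_i add up to n,
    the powers of N can be redistributed, and what is left is

      P / Q = prod_i (m_i^_k_i / m_i^k_i) / (N^_n / N^n)

    (lemma [ln_pmf_ratioE]).  Every factor has the same shape
    m^_k / m^k = prod_(j < k) (1 - j/m), and the regime says exactly that
    k <= gamma m in each of them.  So each logarithm is a sum of ln (1 - j/m)
    with 0 <= j/m <= gamma < 1, a range on which the Taylor polynomial of ln of
    any degree r has an error at most (j/m)^(r+1) / (1 - gamma) (lemma
    [ln1B_taylor]).  Summing over j < k, the error of one factor is at most
    k^(r+2) / m^(r+1) / (1 - gamma) (lemma [ln_ffact_ratio_taylor]), and adding
    up the factors gives precisely the error term of the theorem, with a
    constant independent of d, p, k, n and of N, so that no limit has to be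
    taken (lemma [unif_bigO_taylor]).

    The two expansions are the cases r = 1 and r = 2; their explicit
    polynomials are the closed forms of the sums of j and of j^2 over j < k,
    divided by 1 and 2 respectively. *)

Set Implicit Arguments.
Unset Strict Implicit.
Unset Printing Implicit Defensive.

Import Order.TTheory GRing.Theory Num.Theory.
Import numFieldNormedType.Exports.

Local Open Scope classical_set_scope.
Local Open Scope ring_scope.

(** * Taylor expansion of the logarithm *)

(** The derivatives of the monomials form a geometric sum, which collapses
    against the derivative 1 / (1 - x) of - ln (1 - x).  The parameter c lets
    one formula serve both for the remainder itself (c = 0) and for its
    comparison with the next monomial. *)
Lemma is_derive_ln1B_remainder (R : realType) (r : nat) (c x : R) : x < 1 ->
  is_derive x 1
    (fun y : R => - ln (1 - y) - \sum_(s < r) y ^+ s.+1 / s.+1%:R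
                  - c * (y ^+ r.+1 / r.+1%:R))
    (x ^+ r * ((1 - x)^-1 - c)).
Proof.
move=> x1; have x1' : 1 - x != 0 by rewrite subr_eq0 gt_eqF.
have powD s : is_derive x 1 (fun y : R => y ^+ s.+1 / s.+1%:R) (x ^+ s).
  have -> : (fun y : R => y ^+ s.+1 / s.+1%:R) =
            (s.+1%:R^-1 : R) \*: ((id : R -> R) ^+ s.+1).
    by apply/funext => y /=; rewrite /GRing.scale /= fctE mulrC.
  apply: is_derive_eq.
  by rewrite /GRing.scale /= mulr1 mulrA mulVf ?mul1r // pnatr_eq0.
have lnD : is_derive x 1 (fun y : R => - ln (1 - y)) (1 - x)^-1.
  have subD : is_derive x 1 (fun y : R => 1 - y) (-1).
    have -> : (fun y : R => 1 - y) = cst 1 - id by [].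
    by apply: is_derive_eq; rewrite sub0r.
  have /is_derive1_ln lnD1 : 0 < 1 - x by rewrite subr_gt0.
  have /is_deriveN := @is_derive1_comp _ _ (fun y : R => 1 - y) _ _ _ lnD1 subD.
  by rewrite mulrN1 opprK.
have sumD : is_derive x 1 (fun y : R => \sum_(s < r) y ^+ s.+1 / s.+1%:R)
              (\sum_(s < r) x ^+ s).
  have := is_derive_sum (fun i : 'I_r => powD i).
  by rewrite fct_sumE.
have D := is_deriveB (is_deriveB lnD sumD) (is_deriveZ c (powD r)).
apply: (is_derive_eq D); rewrite /GRing.scale /= mulrBr [c * _]mulrC.
congr (_ - _); apply/eqP; rewrite subr_eq -(inj_eq (mulfI x1')).
rewrite mulrDr mulrCA divff //; apply/eqP.
by have := subrX1 x r; lra.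
Qed.

(** By the mean value theorem on [0, x], both bounds reduce to the sign of the
    derivative y^r * (1 / (1 - y) - c): it is nonnegative for c = 0, and
    nonpositive for c = 1 / (1 - g) because y <= g. *)
Lemma ln1B_taylor (R : realType) (r : nat) (g x : R) : 0 <= x <= g -> g < 1 ->
  0 <= - ln (1 - x) - \sum_(s < r) x ^+ s.+1 / s.+1%:R <= x ^+ r.+1 / (1 - g).
Proof.
move=> /andP[x0 xg] g1.
have x1 : x < 1 by exact: le_lt_trans xg g1.
pose f c (y : R) := - ln (1 - y) - \sum_(s < r) y ^+ s.+1 / s.+1%:R
                  - c * (y ^+ r.+1 / r.+1%:R).
have mvt c : exists2 y, 0 <= y <= x & f c x = y ^+ r * ((1 - y)^-1 - c) * x.
  have fD y : y \in `[0, x] -> is_derive y 1 (f c) (y ^+ r * ((1 - y)^-1 - c)).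
    rewrite in_itv /= => /andP[_ yx].
    by apply: is_derive_ln1B_remainder; exact: le_lt_trans yx x1.
  have fC : {within `[0, x], continuous (f c)}.
    by apply: derivable_within_continuous => y /fD D; exact: ex_derive.
  have fDoo y : y \in `]0, x[ ->
      is_derive y 1 (f c) (y ^+ r * ((1 - y)^-1 - c)).
    by move=> /subset_itv_oo_cc; exact: fD.
  have [y xy e] := MVT_segment x0 fDoo fC.
  have f0 : f c 0 = 0.
    rewrite /f subr0 ln1 oppr0 expr0n mul0r mulr0 big1 ?subr0 // => i _.
    by rewrite expr0n mul0r.
  by exists y => //; rewrite -[x in RHS]subr0 -e f0 subr0.
apply/andP; split.
  have [y /andP[y0 yx]] := mvt 0.
  rewrite /f mul0r !subr0 => ->.
  by rewrite !mulr_ge0 ?exprn_ge0 // invr_ge0 subr_ge0 ltW // (le_lt_trans yx).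
have [y /andP[y0 yx] e] := mvt (1 - g)^-1.
have : f (1 - g)^-1 x <= 0.
  rewrite e mulr_le0_ge0 // mulr_ge0_le0 ?exprn_ge0 // subr_le0.
  rewrite lef_pV2 ?posrE ?subr_gt0 // ?(le_lt_trans yx) //.
  by rewrite lerB // (le_trans yx).
rewrite /f subr_le0 => /le_trans; apply.
(* The factor 1 / r.+1 that integration produces is discarded. *)
rewrite mulrC ler_wpM2r ?invr_ge0 ?subr_ge0 ?(ltW g1) //.
by rewrite ler_pdivrMr ?ltr0n // ler_peMr ?exprn_ge0 ?ler1n.
Qed.

(** * Logarithm of a falling factorial *)

(** Minus the degree r expansion, in powers of 1/m, of the logarithm of
    (m ^_ k) / m ^ k = prod_(j < k) (1 - j/m).  The parameter m is a ring
    element, so that N * p_i can be used without casting it to nat. *)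
Definition ffact_taylor (R : realType) (r : nat) (m : R) (k : nat) : R :=
  \sum_(j < k) \sum_(s < r) (j%:R / m) ^+ s.+1 / s.+1%:R.

Lemma ffact_taylor1 (R : realType) (m : R) (k : nat) :
  ffact_taylor 1 m k = m^-1 * (k%:R ^+ 2 / 2 - k%:R / 2).
Proof.
rewrite /ffact_taylor; elim: k => [|k IH]; first by rewrite big_ord0; ring.
rewrite big_ord_recr /= IH big_ord1 /= -[k.+1%:R]natr1.
by move: m^-1 => a; field.
Qed.

Lemma ffact_taylor2 (R : realType) (m : R) (k : nat) :
  ffact_taylor 2 m k =
  m^-1 * (k%:R ^+ 2 / 2 - k%:R / 2)
  + (m ^+ 2)^-1 * (k%:R ^+ 3 / 6 - k%:R ^+ 2 / 4 + k%:R / 12).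
Proof.
rewrite /ffact_taylor; elim: k => [|k IH]; first by rewrite big_ord0; ring.
rewrite big_ord_recr /= IH !big_ord_recr big_ord0 /= -[k.+1%:R]natr1 -exprVn.
by move: m^-1 => a; field.
Qed.

Lemma ffact_ratioE (R : realType) (m k : nat) : (0 < m)%N -> (k <= m)%N ->
  (m ^_ k)%:R / m%:R ^+ k = \prod_(j < k) (1 - j%:R / m%:R) :> R.
Proof.
move=> m0 km; rewrite ffact_prod natr_prod -[k in X in _ / X]card_ord.
rewrite -prodr_const -prodf_div; apply: eq_bigr => j _.
rewrite natrB ?(leq_trans (ltnW (ltn_ord j))) // mulrBl divff //.
by rewrite pnatr_eq0 -lt0n.
Qed.

Lemma ln_prod (R : realType) (I : Type) (s : seq I) (P : pred I) (F : I -> R) :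
  (forall i, P i -> 0 < F i) ->
  ln (\prod_(i <- s | P i) F i) = \sum_(i <- s | P i) ln (F i).
Proof.
move=> F0; suff [] : 0 < \prod_(i <- s | P i) F i /\
    ln (\prod_(i <- s | P i) F i) = \sum_(i <- s | P i) ln (F i) by [].
elim/big_rec2: _ => [|i y x Pi [x0 <-]]; first by rewrite ln1.
by rewrite mulr_gt0 ?F0 // lnM ?posrE ?F0.
Qed.

(** Each of the k factors 1 - j/m contributes an error at most
    (k/m)^(r+1) / (1 - g), because j/m <= k/m <= g. *)
Lemma ln_ffact_ratio_taylor (R : realType) (r m k : nat) (g : R) :
  (0 < m)%N -> k%:R <= g * m%:R -> g < 1 ->
  `|ln ((m ^_ k)%:R / m%:R ^+ k) + ffact_taylor r (m%:R : R) k|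
    <= (1 - g)^-1 * (k%:R ^+ r.+2 / m%:R ^+ r.+1).
Proof.
move=> m0 kg g1; have mR0 : 0 < m%:R :> R by rewrite ltr0n.
have xg (j : 'I_k) : 0 <= (j%:R / m%:R : R) <= g.
  by rewrite divr_ge0 // ler_pdivrMr // (le_trans _ kg) // ler_nat ltnW.
have km : (k <= m)%N.
  by rewrite -(ler_nat R) (le_trans kg) // ler_piMl // ltW.
rewrite ffact_ratioE // ln_prod; last first.
  move=> j _; have /andP[_ jg] := xg j.
  by rewrite subr_gt0 (le_lt_trans jg).
rewrite -big_split /=.
apply: le_trans (ler_norm_sum _ _ _) _.
have bnd (j : 'I_k) : true ->
    `|ln (1 - j%:R / m%:R) + \sum_(s < r) (j%:R / m%:R) ^+ s.+1 / s.+1%:R|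
    <= (1 - g)^-1 * (k%:R ^+ r.+1 / m%:R ^+ r.+1) :> R.
  move=> _; have /andP[lo hi] := ln1B_taylor r (xg j) g1.
  rewrite -normrN opprD ger0_norm // (le_trans hi) // mulrC.
  rewrite ler_wpM2l ?invr_ge0 ?subr_ge0 ?(ltW g1) // expr_div_n.
  rewrite ler_wpM2r ?invr_ge0 ?exprn_ge0 // lerXn2r ?nnegrE //.
  by rewrite ler_nat ltnW.
apply: le_trans (ler_sum _ bnd) _.
rewrite sumr_const card_ord -mulrnAr ler_wpM2l ?invr_ge0 ?subr_ge0 ?(ltW g1) //.
by rewrite [k%:R ^+ r.+2]exprSr mulrAC mulr_natr.
Qed.

(** * The quotient of the two mass functions *)

(** Membership in n * simplex bounds the sum of the k_j by n, so the truncated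
    subtraction that defines the last coordinate is exact. *)
Lemma sum_kext (R : realType) (d n : nat) (k : 'I_d -> nat) :
  scaled_simplex R n k -> (\sum_(i < d.+1) kext n k i = n)%N.
Proof.
move=> [x [x01 x1] xk]; rewrite (bigD1_ord ord_max) //= /kext unlift_none.
under eq_bigr do rewrite liftK.
apply: subnK; rewrite -(ler_nat R) natr_sum.
have -> : \sum_(j < d) (k j)%:R = n%:R * l1norm x :> R.
  rewrite /l1norm mulr_sumr; apply: eq_bigr => j _.
  have := congr1 (fun v : 'rV[R]_d => v 0 j) xk; rewrite !mxE => <-.
  by rewrite ger0_norm //; have /andP[] := x01 j.
by rewrite ler_piMr.
Qed.

Lemma pext_gt0 (R : realType) (d : nat) (p : 'rV[R]_d) (i : 'I_d.+1) :
  int_simplex p -> 0 < pext p i.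
Proof.
move=> [p01 p1]; rewrite /pext; case: unliftP => [j _|_].
  by have /andP[] := p01 j.
by rewrite subr_gt0.
Qed.

(** For the last coordinate this uses that N - sum_j m_j cannot be negative,
    since the l1 norm of p is below 1. *)
Lemma grid_pext_nat (R : realType) (d N : nat) (p : 'rV[R]_d) (i : 'I_d.+1) :
  (0 < N)%N -> grid N p -> int_simplex p -> N%:R * pext p i \is a Num.nat.
Proof.
move=> N0 [m _ <-] [_ p1].
have NV (a : R) : N%:R * (N%:R^-1 * a) = a by rewrite mulVKf // pnatr_eq0 -lt0n.
have normE : N%:R * l1norm (N%:R^-1 *: natvec R m) = (\sum_j m j)%:R.
  rewrite /l1norm mulr_sumr natr_sum; apply: eq_bigr => j _.
  by rewrite !mxE ger0_norm ?NV // mulr_ge0 ?invr_ge0.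
rewrite /pext; case: unliftP => [j _|_]; first by rewrite !mxE NV natr_nat.
rewrite mulrBr mulr1 normE -natrB ?natr_nat // -(ler_nat R) -normE.
by rewrite ler_piMr // ltW.
Qed.

Lemma natr_bin (R : numFieldType) (m k : nat) :
  ('C(m, k))%:R = (m ^_ k)%:R / (k`!)%:R :> R.
Proof. by rewrite -bin_ffact natrM mulfK // pnatr_eq0 -lt0n fact_gt0. Qed.

(** The identity k_1 + ... + k_(d+1) = n enters when the product of the
    (N p_i)^k_i is rewritten as N^n times the product of the p_i^k_i. *)
Lemma ln_pmf_ratioE (R : realType) (d N n : nat) (p : 'rV[R]_d)
    (k : 'I_d -> nat) :
  (0 < N)%N -> (n <= N)%N -> grid N p -> int_simplex p -> Kset N n p k ->
  let m i := Num.truncn (N%:R * pext p i) in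
  ln (hypergeometric_pmf N n p k / multinomial_pmf n p k) =
  \sum_(i < d.+1) ln ((m i ^_ kext n k i)%:R / (m i)%:R ^+ kext n k i)
  - ln ((N ^_ n)%:R / N%:R ^+ n).
Proof.
move=> N0 nN pN p01 [kn kK] m.
have NR0 : 0 < N%:R :> R by rewrite ltr0n.
have p0 i : 0 < pext p i by exact: pext_gt0.
have mE i : (m i)%:R = N%:R * pext p i by rewrite truncnK // grid_pext_nat.
have m0 i : 0 < (m i)%:R :> R by rewrite mE mulr_gt0.
have km i : (kext n k i <= m i)%N by rewrite -(ler_nat R) mE.
have ff0 i : 0 < (m i ^_ kext n k i)%:R / (m i)%:R ^+ kext n k i :> R.
  by rewrite divr_gt0 ?exprn_gt0 // ltr0n ffact_gt0.
have FF0 : 0 < (N ^_ n)%:R :> R by rewrite ltr0n ffact_gt0.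
rewrite -ln_prod // -ln_div ?posrE ?prodr_gt0 ?divr_gt0 ?exprn_gt0 //.
congr ln; rewrite /hypergeometric_pmf /multinomial_pmf.
rewrite natr_bin; under [X in X / _ / _]eq_bigr do rewrite natr_bin.
rewrite !prodf_div.
have -> : \prod_(i < d.+1) (m i)%:R ^+ kext n k i =
    N%:R ^+ n * \prod_(i < d.+1) pext p i ^+ kext n k i.
  under eq_bigr do rewrite mE exprMn.
  by rewrite big_split /= prodrXr (sum_kext kn).
have nz (a : R) : 0 < a -> a != 0 by move/gt_eqF ->.
have fact0 j : (j`!)%:R != 0 :> R by rewrite pnatr_eq0 -lt0n fact_gt0.
field; rewrite !fact0 !nz ?exprn_gt0 ?prodr_gt0 // => i _.
by rewrite exprn_gt0.
Qed.

(** * Uniform error bounds *)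

(** A bound valid for every N passes to the upper limit; the gap between c and
    C absorbs the strict inequality in the definition. *)
Lemma unif_bigO_bounded (R : realType) (g c C : R) (d : nat)
    (u v : nat -> nat -> 'rV[R]_d -> ('I_d -> nat) -> R) :
  c < C ->
  (forall N n p k, regime g N n p k -> `|u N n p k| <= c * v N n p k) ->
  (forall N n p k, regime g N n p k -> 0 < v N n p k) ->
  unif_bigO g C u v.
Proof.
move=> cC uv v0; rewrite /unif_bigO.
apply: (@le_lt_trans _ _ c%:E); last by rewrite lte_fin.
rewrite limn_esup_lim; apply: lime_le; first exact: is_cvg_esups.
apply: nearW => M; apply: ge_ereal_sup => _ [N _ <-].
apply: ge_ereal_sup => _ [n [p [k [reg ->]]]].
have v0' := v0 _ _ _ _ reg.
by rewrite lee_fin normrM normfV (gtr0_norm v0') ler_pdivrMr // uv.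
Qed.

(** Applying the bound on one falling factorial to N^_n and to each m_i^_k_i
    reproduces, term by term, the terms n^(r+2) / N^(r+1) and
    k_i^(r+2) / (N p_i)^(r+1) of the claimed error. *)
Lemma unif_bigO_taylor (R : realType) (g : R) (d r : nat) : g < 1 ->
  @unif_bigO R g ((1 - g)^-1 + 1) d
    (fun N n p k =>
       ln (hypergeometric_pmf N n p k / multinomial_pmf n p k)
       - (ffact_taylor r N%:R n
          - \sum_(i < d.+1) ffact_taylor r (N%:R * pext p i) (kext n k i)))
    (fun N n p k =>
       (N%:R ^+ r.+1)^-1 *
         (n%:R ^+ r.+2
          + \sum_(i < d.+1) (kext n k i)%:R ^+ r.+2 / pext p i ^+ r.+1)).
Proof.
move=> g1; apply: (@unif_bigO_bounded _ _ (1 - g)^-1).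
- by rewrite ltrDl.
- move=> N n p k [[n0 nN] [pN p01] kK kmax ng].
  have N0 : (0 < N)%N by exact: leq_trans nN.
  rewrite ln_pmf_ratioE //.
  set m := fun i => Num.truncn (N%:R * pext p i).
  have p0 i : 0 < pext p i by exact: pext_gt0.
  have mE i : N%:R * pext p i = (m i)%:R by rewrite truncnK // grid_pext_nat.
  have m0 i : (0 < m i)%N by rewrite -(ltr0n R) -mE mulr_gt0 // ltr0n.
  have kg i : (kext n k i)%:R <= g * (m i)%:R.
    rewrite -mE mulrA -ler_pdivrMr //; apply: le_trans kmax.
    exact: (le_bigmax 0 (fun i => (kext n k i)%:R / pext p i)).
  under [X in _ - (_ - X)]eq_bigr do rewrite mE.
  set S := (X in `|X|).
  have -> : S = \sum_(i < d.+1)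
        (ln ((m i ^_ kext n k i)%:R / (m i)%:R ^+ kext n k i)
         + ffact_taylor r (m i)%:R (kext n k i))
      - (ln ((N ^_ n)%:R / N%:R ^+ n) + ffact_taylor r N%:R n).
    by rewrite /S big_split /=; ring.
  apply: le_trans (ler_normB _ _) _.
  rewrite mulrDr mulrDr addrC; apply: lerD.
    by rewrite [_ * n%:R ^+ _]mulrC; exact: ln_ffact_ratio_taylor.
  apply: le_trans (ler_norm_sum _ _ _) _.
  rewrite !mulr_sumr; apply: ler_sum => i _.
  apply: le_trans (ln_ffact_ratio_taylor r (m0 i) (kg i) g1) _.
  by rewrite -mE exprMn invfM [X in _ * X]mulrCA.
- move=> N n p k [[n0 nN] [_ p01] _ _ _].
  have N0 : (0 < N)%N by exact: leq_trans nN.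
  rewrite mulr_gt0 ?invr_gt0 ?exprn_gt0 ?ltr0n // ltr_wpDr ?exprn_gt0 ?ltr0n //.
  by apply: sumr_ge0 => i _; rewrite divr_ge0 ?exprn_ge0 // ltW ?pext_gt0.
Qed.

Theorem theorem1 (R : realType) (gamma : R) (hgamma : 0 < gamma < 1) :
  (exists2 C : R, 0 < C & forall d : nat, (0 < d)%N ->
    @unif_bigO R gamma C d
      (fun N n p k =>
         ln (hypergeometric_pmf N n p k / multinomial_pmf n p k)
         - N%:R^-1 *
             ((n%:R ^+ 2 / 2 - n%:R / 2)
              - \sum_(i < d.+1) (pext p i)^-1 *
                  ((kext n k i)%:R ^+ 2 / 2 - (kext n k i)%:R / 2)))
      (fun N n p k =>
         (N%:R ^+ 2)^-1 *
           (n%:R ^+ 3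
            + \sum_(i < d.+1) (kext n k i)%:R ^+ 3 / pext p i ^+ 2)))
  /\
  (exists2 C : R, 0 < C & forall d : nat, (0 < d)%N ->
    @unif_bigO R gamma C d
      (fun N n p k =>
         ln (hypergeometric_pmf N n p k / multinomial_pmf n p k)
         - (N%:R^-1 *
              ((n%:R ^+ 2 / 2 - n%:R / 2)
               - \sum_(i < d.+1) (pext p i)^-1 *
                   ((kext n k i)%:R ^+ 2 / 2 - (kext n k i)%:R / 2))
            + (N%:R ^+ 2)^-1 *
              ((n%:R ^+ 3 / 6 - n%:R ^+ 2 / 4 + n%:R / 12)
               - \sum_(i < d.+1) (pext p i ^+ 2)^-1 *
                   ((kext n k i)%:R ^+ 3 / 6 - (kext n k i)%:R ^+ 2 / 4
                    + (kext n k i)%:R / 12))))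
      (fun N n p k =>
         (N%:R ^+ 3)^-1 *
           (n%:R ^+ 4
            + \sum_(i < d.+1) (kext n k i)%:R ^+ 4 / pext p i ^+ 3))).
Proof.
have /andP[_ g1] := hgamma.
have C0 : 0 < (1 - gamma)^-1 + 1 by rewrite addr_gt0 ?invr_gt0 ?subr_gt0.
split; exists ((1 - gamma)^-1 + 1) => // d _.
  have := @unif_bigO_taylor R gamma d 1 g1.
  congr unif_bigO; apply/funext => N; apply/funext => n; apply/funext => p.
  apply/funext => k; rewrite ffact_taylor1; congr (_ - _).
  rewrite [RHS]mulrBr mulr_sumr; congr (_ - _); apply: eq_bigr => i _.
  by rewrite ffact_taylor1 invfM mulrA.
have := @unif_bigO_taylor R gamma d 2 g1.
congr unif_bigO; apply/funext => N; apply/funext => n; apply/funext => p.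
apply/funext => k; rewrite ffact_taylor2; congr (_ - _).
under eq_bigr do
  rewrite ffact_taylor2 exprMn (invfM N%:R) (invfM (N%:R ^+ 2))
    -(mulrA N%:R^-1) -(mulrA (N%:R ^- 2)).
by rewrite big_split /= -!mulr_sumr; ring.
Qed.
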